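(* Let $\mathbb{F}$ be a field with $\mathrm{char}(\mathbb{F})\neq 2,3$. For every $D\in\mathbb{N}$, the map $$(\alpha_0,\dots,\alpha_D)\mapsto\Big(\sum_{i=0}^D\alpha_ia_i\Big)$$ (the ideal of $\hat{\mathcal{H}}$ generated by $\sum_{i=0}^D\alpha_ia_i$) induces a bijection between the set of ideal-type $(D+1)$-tuples $(\alpha_0,\dots,\alpha_D)\in\mathbb{F}^{D+1}$, taken up to non-zero scalar multiples, and the set of minimal ideals of axial codimension $D$ of $\hat{\mathcal{H}}$.
   Context: Notation: $\mathbb{N}=\{1,2,3,\dots\}$, $3\mathbb{N}=\{3,6,9,\dots\}$; for $r\in\mathbb{Z}$, $\bar r=r+3\mathbb{Z}\in\mathbb{Z}_3$. The algebra $\hat{\mathcal{H}}$ is the commutative $\mathbb{F}$-algebra with basis $\{a_i:i\in\mathbb{Z}\}\cup\{s_j:j\in\mathbb{N}\}\cup\{p_{\bar r,k}:\bar r\in\{\bar1,\bar2\},\ k\in 3\mathbb{N}\}$, where $s_0=0$, $p_{\bar r,j}=0$ for all $\bar r$ whenever $j\notin 3\mathbb{N}$, $p_{\bar 0,j}=-p_{\bar1,j}-p_{\bar2,j}$, $z_{\bar r,j}=p_{\bar r+\bar1,j}-p_{\bar r-\bar1,j}$, and for $i,i'\in\mathbb{Z}$, $j,l\in\mathbb{N}$, $h,k\in3\mathbb{N}$, $\bar r,\bar t\in\mathbb{Z}_3$: (H1) $a_ia_{i'}=\tfrac12(a_i+a_{i'})+s_{|i-i'|}+z_{\bar\imath,|i-i'|}$;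 (H2) $a_is_j=-\tfrac34a_i+\tfrac38(a_{i-j}+a_{i+j})+\tfrac32 s_j-z_{\bar\imath,j}$; (H3) $a_ip_{\bar r,k}=\tfrac32p_{\bar r,k}-p_{-(\bar\imath+\bar r),k}$; (H4) $s_js_l=\tfrac34(s_j+s_l)-\tfrac38(s_{|j-l|}+s_{j+l})$; (H5) $s_jp_{\bar r,k}=\tfrac34(p_{\bar r,j}+p_{\bar r,k})-\tfrac38(p_{\bar r,|j-k|}+p_{\bar r,j+k})$; (H6) $p_{\bar r,h}p_{\bar t,k}=\tfrac14(z_{-(\bar r+\bar t),h}+z_{-(\bar r+\bar t),k})-\tfrac18(z_{-(\bar r+\bar t),|h-k|}+z_{-(\bar r+\bar t),h+k})$. A tuple $(\alpha_0,\dots,\alpha_D)\in\mathbb{F}^{D+1}$ is of ideal type if $\alpha_0\neq0\neq\alpha_D$, $\sum_{i=0}^D\alpha_i=0$, and there is $\epsilon\in\{1,-1\}$ with $\alpha_i=\epsilon\alpha_{D-i}$ for all $i=0,\dots,D$. The axial codimension of an ideal $I$ is the dimension of the subspace of $\hat{\mathcal{H}}/I$ spanned by the images of the $a_i$, $i\in\mathbb{Z}$. An ideal $I$ of axial codimension $D$ has pattern $(\alpha_0,\dots,\alpha_D)$ (with $\alpha_0\neq0\neq\alpha_D$) if $\sum_{i=0}^D\alpha_ia_i\in I$. A minimal ideal of axial codimension $D$ is an ideal of axial codimension $D$ which is minimal with respect to inclusion among the ideals of axial codimension $D$ having the same pattern. *)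

(* Defs.v *)
From HB Require Import structures.
From mathcomp Require Import all_boot all_order all_algebra.
From mathcomp Require Import finmap.
From mathcomp.multinomials Require Import monalg.
Set Implicit Arguments. Unset Strict Implicit. Unset Printing Implicit Defensive.
Import Order.TTheory GRing.Theory Num.Theory.
Local Open Scope ring_scope.

(* Basis of \hat H:
   HA i      = a_i          (i : int)
   HS n      = s_(n+1)      (so j = n+1 ranges over N = {1,2,...})
   HP b m    = p_(r, 3(m+1)) with r = 1 if b = false, r = 2 if b = true
                            (so k = 3(m+1) ranges over 3N). *)
Inductive hbasis := HA of int | HS of nat | HP of bool & nat.

Definition hbasis_enc (x : hbasis) : int + nat + (bool * nat) :=
  match x with HA i => inl (inl i) | HS n => inl (inr n) | HP b m => inr (b, m) end.
Definition hbasis_dec (y : int + nat + (bool * nat)) : hbasis :=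
  match y with inl (inl i) => HA i | inl (inr n) => HS n | inr (b, m) => HP b m end.
Lemma hbasis_encK : cancel hbasis_enc hbasis_dec. Proof. by case. Qed.
HB.instance Definition _ := Countable.copy hbasis (can_type hbasis_encK).

Section Hhat.
Variable F : fieldType.

Definition HV := {malg F[hbasis]}.
Definition hb (b : hbasis) : HV := << (1 : F) *g b >>.

Definition ha (i : int) : HV := hb (HA i).
Definition hs (j : nat) : HV := if j is j'.+1 then hb (HS j') else 0.
Definition hp12 (b : bool) (k : nat) : HV :=
  if (0 < k)%N && (3 %| k)%N then hb (HP b (k %/ 3).-1) else 0.
Definition hp (r : int) (k : nat) : HV :=
  if (r %% 3)%Z == 1 then hp12 false k
  else if (r %% 3)%Z == 2 then hp12 true k
  else - hp12 false k - hp12 true k.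
Definition hz (r : int) (j : nat) : HV := hp (r + 1) j - hp (r - 1) j.

Definition half : F := (2%:R)^-1.
Definition q34 : F := 3%:R / 4%:R.
Definition q38 : F := 3%:R / 8%:R.
Definition q32 : F := 3%:R / 2%:R.
Definition q14 : F := (4%:R)^-1.
Definition q18 : F := (8%:R)^-1.

Definition rof (b : bool) : int := if b then 2 else 1.
Definition kof (m : nat) : nat := 3 * m.+1.
Definition dist (j l : nat) : nat := `|(j%:Z - l%:Z)|%N.

Definition prodAS (i : int) (j : nat) : HV :=
  - (q34 *: ha i) + q38 *: (ha (i - j%:Z) + ha (i + j%:Z)) + q32 *: hs j - hz i j.
Definition prodAP (i r : int) (k : nat) : HV :=
  q32 *: hp r k - hp (- (i + r)) k.
Definition prodSP (j : nat) (r : int) (k : nat) : HV :=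
  q34 *: (hp r j + hp r k) - q38 *: (hp r (dist j k) + hp r (j + k)).

Definition prodB (x y : hbasis) : HV :=
  match x, y with
  | HA i, HA i' => half *: (ha i + ha i') + hs `|i - i'|%N + hz i `|i - i'|%N
  | HA i, HS l => prodAS i l.+1
  | HS l, HA i => prodAS i l.+1
  | HA i, HP b m => prodAP i (rof b) (kof m)
  | HP b m, HA i => prodAP i (rof b) (kof m)
  | HS j, HS l => q34 *: (hs j.+1 + hs l.+1)
                  - q38 *: (hs (dist j.+1 l.+1) + hs (j.+1 + l.+1))
  | HS j, HP b m => prodSP j.+1 (rof b) (kof m)
  | HP b m, HS j => prodSP j.+1 (rof b) (kof m)
  | HP b m, HP b' m' =>
      let t := - (rof b + rof b') in
      let h := kof m in let k := kof m' in
      q14 *: (hz t h + hz t k) - q18 *: (hz t (dist h k) + hz t (h + k))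
  end.

Definition hmul (u v : HV) : HV :=
  \sum_(x <- msupp u) \sum_(y <- msupp v) (u@_x * v@_y) *: prodB x y.

Definition is_ideal (I : HV -> Prop) : Prop :=
  [/\ I 0,
      (forall x y, I x -> I y -> I (x + y)),
      (forall (c : F) x, I x -> I (c *: x)) &
      (forall u x, I x -> I (hmul u x))].

Definition gen_ideal (x : HV) : HV -> Prop :=
  fun v => forall I, is_ideal I -> I x -> I v.

(* axial codimension D of I: the subspace of \hat H / I spanned by the images
   of the a_i has dimension D, i.e. it has a basis (images of v_0..v_{D-1}) *)
Definition axial_codim (I : HV -> Prop) (D : nat) : Prop :=
  exists v : 'I_D -> HV,
    [/\ (forall k, exists n (idx : 'I_n -> int) (c : 'I_n -> F),
            I (v k - \sum_(l < n) c l *: ha (idx l))),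
        (forall c : 'I_D -> F, I (\sum_(k < D) c k *: v k) -> forall k, c k = 0) &
        (forall j : int, exists c : 'I_D -> F, I (ha j - \sum_(k < D) c k *: v k))].

Definition lincomb (D : nat) (alpha : 'I_D.+1 -> F) : HV :=
  \sum_(i < D.+1) alpha i *: ha (i : nat)%:Z.

Definition has_pattern (I : HV -> Prop) (D : nat) (alpha : 'I_D.+1 -> F) : Prop :=
  [/\ axial_codim I D, alpha ord0 != 0, alpha ord_max != 0 & I (lincomb alpha)].
Arguments has_pattern : clear implicits.

Definition minimal_ideal (I : HV -> Prop) (D : nat) : Prop :=
  is_ideal I /\
  exists alpha : 'I_D.+1 -> F,
    has_pattern I D alpha /\
    forall J, is_ideal J -> has_pattern J D alpha ->
      (forall v, J v -> I v) -> forall v, I v -> J v.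

Definition ideal_type (D : nat) (alpha : 'I_D.+1 -> F) : Prop :=
  [/\ alpha ord0 != 0, alpha ord_max != 0, \sum_(i < D.+1) alpha i = 0 &
      exists eps : F, (eps = 1 \/ eps = -1) /\
        forall i : 'I_D.+1, alpha i = eps * alpha (rev_ord i)].

End Hhat.

(* Main.v *)
(* A nonzero augmentation of x = sum_i c_i a_(e_i) in an ideal I puts every a_j in
   I, since the projection of x to the 1-eigenspace of a_j is a multiple of a_j.  If
   the augmentation is zero, the products a_k (a_j x) and s_1 x show that I contains
   all translates and reflections of x.  Hence, in an ideal of axial codimension D
   with pattern alpha, a_0, ..., a_(D-1) are a basis modulo I, and reflecting the
   relation alpha shows that alpha is of ideal type.

   Conversely, let alpha be of ideal type.  The ideal generated by its relation has
   axial codimension at most D; for the lower bound it is contained in an ideal that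
   ignores the p's and is cut out by linear functionals, namely a_i |-> u_i for the
   solutions u of the recurrence alpha, and s_j |-> w_j - w_0 for its even solutions
   w.  The recurrence has a solution with any prescribed values u_0, ..., u_(D-1). *)
Require Import Defs.
From HB Require Import structures.
From mathcomp Require Import all_boot all_order all_algebra.
From mathcomp Require Import finmap.
From mathcomp.multinomials Require Import monalg.
From mathcomp Require Import zify ring.
Set Implicit Arguments. Unset Strict Implicit. Unset Printing Implicit Defensive.
Import Order.TTheory GRing.Theory Num.Theory.
Local Open Scope ring_scope.

(** * Linear maps defined by their values on the basis *)

Section LinearExtension.
Variables (F : fieldType) (V : lmodType F).
Implicit Types (f g : hbasis -> V) (v : HV F).

Definition lext f v : V := \sum_(x <- msupp v) v@_x *: f x.

(** Vectors with different supports can be compared only after their sums are taken over one common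
    finite set. *)
Lemma lextEw (E : {fset hbasis}) f v : (msupp v `<=` E)%fset ->
  lext f v = \sum_(x <- E) v@_x *: f x.
Proof.
move=> sE; rewrite /lext (big_fset_incl _ sE) // => x _ /mcoeff_outdom ->.
by rewrite scale0r.
Qed.

Lemma lext_is_linear f : linear (lext f).
Proof.
move=> c u v; pose E := (msupp u `|` msupp v `|` msupp (c *: u + v))%fset.
have su : (msupp u `<=` E)%fset by rewrite /E -fsetUA fsubsetUl.
have sv : (msupp v `<=` E)%fset by rewrite /E fsetUAC fsubsetUr.
have sw : (msupp (c *: u + v) `<=` E)%fset by rewrite /E fsubsetUr.
rewrite (lextEw f sw) (lextEw f su) (lextEw f sv) scaler_sumr -big_split /=.
by apply: eq_bigr => x _; rewrite mcoeffD mcoeffZ scalerDl scalerA.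
Qed.

HB.instance Definition _ f :=
  GRing.isLinear.Build F (HV F) V _ (lext f) (lext_is_linear f).

Lemma lext_hb f b : lext f (hb F b) = f b.
Proof.
rewrite (lextEw (E := [fset b]%fset)); last by rewrite /hb msuppU_le.
by rewrite big_seq_fset1 mcoeffUU scale1r.
Qed.

Lemma lextD f g v : lext (fun b => f b + g b) v = lext f v + lext g v.
Proof. by rewrite /lext -big_split; apply: eq_bigr => x _; rewrite scalerDr. Qed.

Lemma lextZ c f v : lext (fun b => c *: f b) v = c *: lext f v.
Proof.
by rewrite /lext scaler_sumr; apply: eq_bigr => x _; rewrite !scalerA mulrC.
Qed.

Lemma eq_lext f g : f =1 g -> lext f =1 lext g.
Proof. by move=> fg v; apply: eq_bigr => x _; rewrite fg. Qed.

End LinearExtension.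

Lemma linear_lext (F : fieldType) (V W : lmodType F) (h : {linear V -> W})
  (f : hbasis -> V) v : h (lext f v) = lext (h \o f) v.
Proof. by rewrite linear_sum; apply: eq_bigr => x _; rewrite linearZ. Qed.

Lemma addrKl (V : zmodType) (x y z : V) : x + y - (x + z) = y - z.
Proof. by rewrite opprD addrACA subrr add0r. Qed.

(** * Multiplication by basis elements *)

Section Products.
Variable F : fieldType.
Hypothesis F2 : (2%:R : F) != 0.
Hypothesis F3 : (3%:R : F) != 0.
Local Notation H := (HV F).
Local Notation ha := (ha F).
Local Notation hs := (hs F).
Local Notation hp := (hp F).
Local Notation hz := (hz F).
Local Notation half := (Defs.half F).

Definition lmul (b : hbasis) : H -> H := lext (prodB F b).
HB.instance Definition _ b := GRing.Linear.on (lmul b).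

Lemma lmulD b u v : lmul b (u + v) = lmul b u + lmul b v.
Proof. exact: linearD. Qed.

Lemma lmulZ b c v : lmul b (c *: v) = c *: lmul b v.
Proof. exact: linearZ. Qed.

Lemma lmulB b u v : lmul b (u - v) = lmul b u - lmul b v.
Proof. exact: linearB. Qed.

Lemma hmulE u v : hmul u v = lext (lmul^~ v) u.
Proof.
apply: eq_bigr => x _; rewrite scaler_sumr.
by apply: eq_bigr => y _; rewrite scalerA.
Qed.

Lemma hmul_hb b v : hmul (hb F b) v = lmul b v.
Proof. by rewrite hmulE lext_hb. Qed.

Lemma is_ideal_lmul (I : H -> Prop) :
  I 0 -> (forall x y, I x -> I y -> I (x + y)) ->
  (forall c x, I x -> I (c *: x)) -> (forall b x, I x -> I (lmul b x)) ->
  is_ideal I.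
Proof.
move=> I0 ID IZ IM; split=> // u x Ix; rewrite hmulE.
by apply: big_ind => // b _; apply/IZ/IM.
Qed.

Lemma F4 : (4%:R : F) != 0.
Proof. by rewrite (natrM _ 2 2) mulf_neq0. Qed.

Lemma F8 : (8%:R : F) != 0.
Proof. by rewrite (natrM _ 2 4) mulf_neq0 // F4. Qed.

Lemma hp_mod (r r' : int) k : (r = r' %[mod 3])%Z -> hp r k = hp r' k.
Proof. by rewrite /hp => ->. Qed.

Lemma hz_mod (r r' : int) k : (r = r' %[mod 3])%Z -> hz r k = hz r' k.
Proof.
move=> rr'; rewrite /hz; congr (_ - _); apply: hp_mod.
  by rewrite -modzDml rr' modzDml.
by rewrite -modzDml rr' modzDml.
Qed.

Lemma hp_sum (r : int) k : hp r k + hp (r + 1) k + hp (r - 1) k = 0.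
Proof.
have: (r %% 3)%Z = 0 \/ (r %% 3)%Z = 1 \/ (r %% 3)%Z = 2 by lia.
have shift (d : int) : ((r + d) %% 3)%Z = (((r %% 3)%Z + d) %% 3)%Z.
  by rewrite modzDml.
rewrite /hp !shift; case=> [|[|]] -> /=;
  move: (hp12 F false k) (hp12 F true k) => x y; apply/malgP => b;
  rewrite !(mcoeffD, mcoeffN, mcoeff0); ring.
Qed.

Lemma lmul_AA j i : lmul (HA j) (ha i) =
  half *: (ha j + ha i) + hs `|j - i|%N + hz j `|j - i|%N.
Proof. by rewrite /lmul lext_hb. Qed.

Lemma lmul_hp12 j b k :
  lmul (HA j) (hp12 F b k) = q32 F *: hp12 F b k - hp (- (j + rof b)) k.
Proof.
rewrite /hp /hp12; case: ifP => [/andP[k0 k3]|]; last first.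
  by rewrite linear0 subr0 oppr0 !if_same scaler0 subr0.
rewrite /lmul lext_hb /= /prodAP.
have -> : kof (k %/ 3).-1 = k by rewrite /kof; lia.
by rewrite /hp /hp12 k0 k3 /rof; case: b.
Qed.

(** The multiplication table has this rule for residues 1 and 2 only. For residue 0 it follows
    because the three p's of one index sum to zero. *)
Lemma lmul_hp j r k : lmul (HA j) (hp r k) = prodAP F j r k.
Proof.
have: (r %% 3)%Z = 1 \/ (r %% 3)%Z = 2 \/ (r %% 3)%Z = 0 by lia.
rewrite /prodAP {1 2}/hp; case=> [e|[e|e]]; rewrite e /=.
- by rewrite lmul_hp12 (@hp_mod (- (j + r)) (- (j + rof false))) //=; lia.
- by rewrite lmul_hp12 (@hp_mod (- (j + r)) (- (j + rof true))) //=; lia.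
rewrite linearB linearN /= !lmul_hp12.
rewrite (@hp_mod (- (j + rof false)) (- (j + r) - 1)); last by rewrite /=; lia.
rewrite (@hp_mod (- (j + rof true)) (- (j + r) + 1)); last by rewrite /=; lia.
have /eqP := hp_sum (- (j + r)) k; rewrite addrAC addr_eq0 => /eqP eq1.
have -> : hp (- (j + r) + 1) k = - hp (- (j + r)) k - hp (- (j + r) - 1) k.
  by rewrite -opprD eq1 opprK.
move: (hp12 F _ _) (hp12 F _ _) (hp _ _) (hp _ _) => x y z t.
by apply/malgP => b; rewrite !(mcoeffD, mcoeffN, mcoeffZ); ring.
Qed.

(** The map r to -(j + r) reverses orientation, so it exchanges the two terms of z; hence the plus
    sign. *)
Lemma lmul_hz j r k :
  lmul (HA j) (hz r k) = q32 F *: hz r k + hz (- (j + r)) k.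
Proof.
rewrite /hz linearB /= !lmul_hp /prodAP.
have -> : - (j + (r + 1)) = - (j + r) - 1 by lia.
have -> : - (j + (r - 1)) = - (j + r) + 1 by lia.
move: (hp _ k) (hp _ k) (hp _ k) (hp _ k) => x y z t.
by rewrite scalerBr opprD opprK addrACA [- _ + _]addrC.
Qed.

Lemma hz0 r : hz r 0 = 0.
Proof. by rewrite /hz /hp /hp12 /= oppr0 addr0 !if_same subr0. Qed.

Lemma hz1 r : hz r 1 = 0.
Proof. by rewrite /hz /hp /hp12 /= oppr0 addr0 !if_same subr0. Qed.

Lemma lmul_hs j n : lmul (HA j) (hs n) = prodAS F j n.
Proof.
case: n => [|n]; last by rewrite /lmul lext_hb.
(* At n = 0 all axes coincide and their coefficients -3/4 + 3/8 + 3/8 cancel, in agreement with s_0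
   = 0. *)
rewrite linear0 /prodAS hz0 /= subr0 addr0 scaler0 addr0.
move: (ha j) => x.
apply/malgP => b; rewrite !(mcoeffD, mcoeffN, mcoeffZ, mcoeff0) /q34 /q38.
by field; rewrite ?F4 ?F8.
Qed.

(* When [k = j] modulo 3, [hs n + hz j n] behaves under [ha k] exactly as
   [hs n] does in the quotient where all the [hp] vanish. *)
Lemma lmul_hsz (k j : int) n : (k = j %[mod 3])%Z ->
  lmul (HA k) (hs n + hz j n) =
  (- q34 F) *: ha k + q38 F *: (ha (k - n%:Z) + ha (k + n%:Z))
  + q32 F *: (hs n + hz j n).
Proof.
move=> kj; rewrite linearD /= lmul_hs lmul_hz /prodAS.
rewrite (hz_mod n kj) (@hz_mod (- (k + j)) j); last by lia.
move: (ha k) (ha (k - n%:Z)) (ha (k + n%:Z)) (hs n) (hz j n) => x y z s t.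
apply/malgP => b; rewrite !(mcoeffD, mcoeffN, mcoeffZ); by ring.
Qed.

Lemma lmul_sa n i : lmul (HS n) (ha i) = prodAS F i n.+1.
Proof. by rewrite /lmul lext_hb. Qed.

Lemma lmul_haa j : lmul (HA j) (ha j) = ha j.
Proof.
rewrite lmul_AA subrr hz0 !addr0 -mulr2n -scaler_nat scalerA.
by rewrite /Defs.half (mulVf F2) scale1r.
Qed.

Local Opaque Defs.ha Defs.hs Defs.hp Defs.hz lmul.

Definition comb n (c : 'I_n -> F) (w : 'I_n -> H) : H := \sum_i c i *: w i.

Lemma combD n (c : 'I_n -> F) w w' :
  comb c (fun i => w i + w' i) = comb c w + comb c w'.
Proof. by rewrite -big_split; apply: eq_bigr => i _; rewrite scalerDr. Qed.

Lemma combZ n (c : 'I_n -> F) a w : comb c (fun i => a *: w i) = a *: comb c w.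
Proof.
by rewrite scaler_sumr; apply: eq_bigr => i _; rewrite !scalerA mulrC.
Qed.

Lemma comb_const n (c : 'I_n -> F) u : comb c (fun=> u) = (\sum_i c i) *: u.
Proof. by rewrite scaler_suml. Qed.

Lemma eq_comb n (c : 'I_n -> F) w w' : w =1 w' -> comb c w = comb c w'.
Proof. by move=> ww; apply: eq_bigr => i _; rewrite ww. Qed.

Lemma linear_comb (h : {linear H -> H}) n (c : 'I_n -> F) w :
  h (comb c w) = comb c (fun i => h (w i)).
Proof. by rewrite linear_sum; apply: eq_bigr => i _; rewrite linearZ. Qed.

(** A term common to all i contributes only through the sum of the coefficients. *)
Lemma comb_affine n (c : 'I_n -> F) v a u b w d w' :
  (forall i, v i = a *: u + b *: w i + d *: w' i) ->
  comb c v = (a * \sum_i c i) *: u + b *: comb c w + d *: comb c w'.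
Proof. by move/eq_comb->; rewrite !combD !combZ comb_const scalerA. Qed.

(** * Translates and reflections of a combination of axes inside an ideal *)

Section Ideal.
Variable I : H -> Prop.
Hypothesis idI : is_ideal I.

Lemma ideal0 : I 0. Proof. by case: idI. Qed.
Lemma idealD u v : I u -> I v -> I (u + v). Proof. by case: idI => _ + _ _; apply. Qed.
Lemma idealZ c u : I u -> I (c *: u). Proof. by case: idI => _ _ + _; apply. Qed.
Lemma idealN u : I u -> I (- u).
Proof. by rewrite -scaleN1r; apply: idealZ. Qed.
Lemma idealB u v : I u -> I v -> I (u - v).
Proof. by move=> Iu /idealN; apply: idealD. Qed.
Lemma idealZI c u : c != 0 -> I (c *: u) -> I u.
Proof. by move=> c0 /(@idealZ c^-1); rewrite scalerK. Qed.
Lemma ideal_sum n (w : 'I_n -> H) : (forall i, I (w i)) -> I (\sum_i w i).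
Proof.
by move=> Iw; apply: big_ind => //; [apply: ideal0 | apply: idealD].
Qed.
Lemma ideal_addsub u v : I (u + v) -> I (u - v) -> I u /\ I v.
Proof.
move=> Is Id; split; apply: (idealZI F2); rewrite scaler_nat mulr2n.
  by have := idealD Is Id; rewrite addrACA subrr addr0.
by have := idealB Is Id; rewrite addrKl opprK.
Qed.
Lemma ideal_lmul b u : I u -> I (lmul b u).
Proof. by rewrite -hmul_hb; case: idI => _ _ _; apply. Qed.

(* The span of [a, x + x', y] is invariant under [lmul b], whose eigenvalues on it
   are 1, 0, 2; the component of [x] in the 1-eigenspace is [s *: a]. *)
Lemma ideal_span4 b s a x x' y :
  lmul b a = a ->
  lmul b x = (half * s) *: a + half *: x + y ->
  lmul b x' = (half * s) *: a + half *: x' + y ->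
  lmul b y = (- q34 F * s) *: a + q38 F *: (x + x') + q32 F *: y ->
  I x -> s != 0 -> I a.
Proof.
move=> La Lx Lx' Ly Ix s0.
have Iq : I ((half * s) *: a + y).
  have := idealB (ideal_lmul b Ix) (idealZ half Ix).
  by rewrite Lx addrAC addrK.
(* Applying [lmul b] - 3/2 to the previous element removes y; the factor 8/3 normalises x + x'. *)
have Iw : I (x + x' - (8%:R / 3%:R * s) *: a).
  have := idealB (ideal_lmul b Iq) (idealZ (q32 F) Iq).
  move=> /(idealZ (8%:R / 3%:R)); congr I.
  rewrite lmulD lmulZ La Ly /Defs.half /q34 /q38 /q32.
  apply/malgP => k; rewrite !(mcoeffD, mcoeffN, mcoeffZ).
  by field; rewrite ?F4 ?F8 ?F2 ?F3.
(* Now [lmul b] - 1/2 removes x + x', and the 2 y it creates is cancelled by [Iq]; on a there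
   remains 1 - 8/3 + 4/3 - 1 = -4/3. *)
have Iu : I ((- (4%:R / 3%:R) * s) *: a).
  have := idealB (ideal_lmul b Iw) (idealZ half Iw).
  move=> /(fun h => idealB h (idealZ 2%:R Iq)); congr I.
  rewrite lmulB lmulD lmulZ La Lx Lx' /Defs.half.
  apply/malgP => k; rewrite !(mcoeffD, mcoeffN, mcoeffZ).
  by field; rewrite ?F4 ?F8 ?F2 ?F3.
by apply: idealZI Iu; rewrite mulf_neq0 // oppr_eq0 mulf_neq0 ?invr_eq0 ?F4.
Qed.

Section Combinations.
Variables (n : nat) (c : 'I_n -> F).
Implicit Type e : 'I_n -> int.
(** [sg] is the augmentation of the combination [A e] of axes, and [Y e j] is the s- and z-part of
    its product with a_j. *)
Let sg := \sum_i c i.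
Let A e := comb c (fun i => ha (e i)).
Let Y e j := comb c (fun i => hs `|j - e i|%N + hz j `|j - e i|%N).

Lemma comb_ext e e' : e =1 e' -> A e = A e'.
Proof. by move=> ee; apply: eq_comb => i; rewrite ee. Qed.

Lemma ideal_comb_ext e e' : e =1 e' -> I (A e) -> I (A e').
Proof. by move/comb_ext->. Qed.

Lemma lmul_combA j e :
  lmul (HA j) (A e) = (half * sg) *: ha j + half *: A e + Y e j.
Proof.
rewrite linear_comb -[Y e j]scale1r; apply: comb_affine => i /=.
by rewrite lmul_AA scalerDr scale1r !addrA.
Qed.

Lemma ideal_combY j e : I (A e) -> I ((half * sg) *: ha j + Y e j).
Proof.
move=> IA; have := idealB (ideal_lmul (HA j) IA) (idealZ half IA).
by rewrite lmul_combA addrAC addrK.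
Qed.

(** Whatever the sign of j - e_i, the points k - |j - e_i| and k + |j - e_i| are k - j + e_i and k +
    j - e_i in some order. The axes thus form a translate plus a reflection of [A e]. *)
Lemma lmul_combY k j e : (k = j %[mod 3])%Z -> lmul (HA k) (Y e j) =
  (- q34 F * sg) *: ha k
  + q38 F *: (A (fun i => k - j + e i) + A (fun i => k + j - e i))
  + q32 F *: Y e j.
Proof.
move=> kj; rewrite linear_comb -combD; apply: comb_affine => i /=.
rewrite (lmul_hsz _ kj).
suff -> : ha (k - `|j - e i|%N%:Z) + ha (k + `|j - e i|%N%:Z) =
    ha (k - j + e i) + ha (k + j - e i) by [].
set d := (`|j - e i|%N : int).
have: (k - d = k - j + e i /\ k + d = k + j - e i) \/
      (k - d = k + j - e i /\ k + d = k - j + e i) by lia.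
by case=> -[-> ->]; last exact: addrC.
Qed.

(** [ideal_span4] applies with x' the reflection of x = [A e] at j: both have the same distances to
    j, hence the same y = [Y e j]. *)
Lemma ideal_sum_neq0 e j : I (A e) -> sg != 0 -> I (ha j).
Proof.
move=> IA sg0; pose e' i := j + j - e i.
have Y'E : Y e' j = Y e j.
  apply: eq_comb => i; rewrite /e'.
  have -> : j - (j + j - e i) = - (j - e i) by lia.
  by rewrite abszN.
have Lx' := lmul_combA j e'; rewrite Y'E in Lx'.
have LY := lmul_combY e (erefl (j %% 3)%Z).
have xE : A (fun i => j - j + e i) = A e.
  by apply: comb_ext => i; rewrite subrr add0r.
rewrite xE in LY.
exact: (ideal_span4 (lmul_haa j) (lmul_combA j e) Lx' LY IA sg0).
Qed.

Section ZeroSum.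
Hypothesis sg0 : sg = 0.

(** With zero augmentation [Y e j] itself lies in the ideal, and a_k Y - (3/2) Y is 3/8 of this
    sum. *)
Lemma ideal_translate_reflect k j e : (k = j %[mod 3])%Z -> I (A e) ->
  I (A (fun i => k - j + e i) + A (fun i => k + j - e i)).
Proof.
move=> kj IA; have := ideal_combY j IA; rewrite sg0 mulr0 scale0r add0r => IY.
have := idealB (ideal_lmul (HA k) IY) (idealZ (q32 F) IY).
rewrite (lmul_combY _ kj) addrK sg0 mulr0 scale0r add0r; apply: idealZI.
by rewrite mulf_neq0 // invr_eq0 F8.
Qed.

(** For j = k the translate is [A e] itself and can be subtracted. *)
Lemma ideal_reflect_even k e : I (A e) -> I (A (fun i => k + k - e i)).
Proof.
move=> IA; have := @ideal_translate_reflect k k e erefl IA.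
rewrite (@comb_ext _ e) => [/idealB/(_ IA)|i]; first by rewrite addrAC subrr add0r.
by rewrite subrr add0r.
Qed.

Lemma ideal_translate_diff e :
  I (A e) -> I (A (fun i => 1 + e i) - A (fun i => -1 + e i)).
Proof.
move=> /(@ideal_reflect_even 0) IA.
(* The pairs (k, j) = (2, -1) and (1, -2) are congruent modulo 3 and share k - j = 3, while k + j is
   1 and -1. Applied to the reflected combination, their difference loses the common translate and
   keeps the two unit translates of [A e]. *)
have I1 := @ideal_translate_reflect 2 (-1) _ erefl IA.
have I2 := @ideal_translate_reflect 1 (-2%:Z) _ erefl IA.
move: (idealB I1 I2); congr I.
rewrite (@comb_ext (fun i => 2 - -1 + (0 + 0 - e i))
                   (fun i => 1 - -2%:Z + (0 + 0 - e i))); last by move=> i; lia.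
rewrite addrKl.
rewrite (@comb_ext (fun i => 2 + -1 - _) (fun i => 1 + e i)); last by move=> i; lia.
by rewrite (@comb_ext (fun i => 1 + -2%:Z - _) (fun i => -1 + e i)) // => i; lia.
Qed.

Lemma ideal_translate_sum e :
  I (A e) -> I (A (fun i => 1 + e i) + A (fun i => -1 + e i)).
Proof.
move=> IA.
(* [HS 0] is s_1; since 3 does not divide 1, no z-terms occur in its products with axes. *)
have := idealD (ideal_lmul (HS 0) IA) (idealZ (q34 F) IA).
have -> : lmul (HS 0) (A e) = (q32 F * sg) *: hs 1
    + q38 F *: (A (fun i => 1 + e i) + A (fun i => -1 + e i)) + (- q34 F) *: A e.
  rewrite linear_comb -combD; apply: comb_affine => i /=.
  rewrite lmul_sa /prodAS hz1 subr0 scaleNr [LHS]addrC !addrA.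
  have -> : e i - 1%:Z = -1 + e i by lia.
  by rewrite [e i + _]addrC [ha (-1 + _) + _]addrC addrAC.
rewrite sg0 mulr0 scale0r add0r scaleNr addrNK; apply: idealZI.
by rewrite mulf_neq0 // invr_eq0 F8.
Qed.

Lemma ideal_translate m e : I (A e) -> I (A (fun i => m + e i)).
Proof.
have step f : I (A f) -> I (A (fun i => 1 + f i)) /\ I (A (fun i => -1 + f i)).
  by move=> If; apply: ideal_addsub (ideal_translate_sum If) (ideal_translate_diff If).
elim/int_rect: m e => [|m IH|m IH] e IA.
- by apply: ideal_comb_ext IA => i; rewrite add0r.
- have [/IH IB _] := step _ IA.
  by apply: ideal_comb_ext IB => i; lia.
have [_ /IH IB] := step _ IA.
by apply: ideal_comb_ext IB => i; lia.
Qed.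

Lemma ideal_reflect m e : I (A e) -> I (A (fun i => m - e i)).
Proof.
move=> /(@ideal_reflect_even 0)/(@ideal_translate m).
by apply: ideal_comb_ext => i; rewrite addr0 sub0r.
Qed.

End ZeroSum.
End Combinations.
End Ideal.

End Products.

(** * An ideal cut out by solutions of a linear recurrence *)

Section Annihilator.
Variable F : fieldType.
Hypothesis F2 : (2%:R : F) != 0.
Hypothesis F3 : (3%:R : F) != 0.
Local Notation H := (HV F).
Local Notation ha := (ha F).
Local Notation hs := (hs F).
Local Notation hp := (hp F).
Local Notation hz := (hz F).
Local Notation half := (Defs.half F).
Implicit Types u w : int -> F.

Definition afun u (b : hbasis) : F^o := if b is HA i then u i else 0.
(** Subtracting w 0 makes the value at s_j formally zero for j = 0, as s_0 = 0 requires. *)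
Definition sfun w (b : hbasis) : F^o := if b is HS j then w j.+1%:Z - w 0 else 0.

Lemma lext_hp (g : hbasis -> F^o) r k :
  (forall b m, g (HP b m) = 0) -> lext g (hp r k) = 0.
Proof.
move=> g0; have g12 b : lext g (hp12 F b k) = 0.
  by rewrite /hp12; case: ifP => _; rewrite ?linear0 // lext_hb g0.
by rewrite /Defs.hp; do 2?case: ifP => _; rewrite ?linearB ?linearN /= !g12 ?oppr0 ?addr0.
Qed.

Lemma afun_hp u r k : lext (afun u) (hp r k) = 0.
Proof. exact: lext_hp. Qed.
Lemma sfun_hp w r k : lext (sfun w) (hp r k) = 0.
Proof. exact: lext_hp. Qed.
Lemma afun_hz u r k : lext (afun u) (hz r k) = 0.
Proof. by rewrite linearB /= !afun_hp subr0. Qed.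
Lemma sfun_hz w r k : lext (sfun w) (hz r k) = 0.
Proof. by rewrite linearB /= !sfun_hp subr0. Qed.
Lemma afun_ha u i : lext (afun u) (ha i) = u i.
Proof. by rewrite lext_hb. Qed.
Lemma sfun_ha w i : lext (sfun w) (ha i) = 0.
Proof. by rewrite lext_hb. Qed.
Lemma afun_hs u n : lext (afun u) (hs n) = 0.
Proof. by case: n => [|n]; rewrite ?linear0 // lext_hb. Qed.
Lemma sfun_hs w n : lext (sfun w) (hs n) = w n%:Z - w 0.
Proof. by case: n => [|n]; rewrite ?linear0 ?subrr // lext_hb. Qed.

Lemma lfD (g : hbasis -> F^o) x y : lext g (x + y) = lext g x + lext g y :> F.
Proof. by rewrite linearD. Qed.
Lemma lfN (g : hbasis -> F^o) x : lext g (- x) = - lext g x :> F.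
Proof. by rewrite linearN. Qed.
Lemma lfZ (g : hbasis -> F^o) c x : lext g (c *: x) = c * lext g x :> F.
Proof. by rewrite linearZ. Qed.

(** One lemma for each shape of right-hand side in the multiplication table, so that a single
    rewrite expands a product. *)
Lemma lf_AA (g : hbasis -> F^o) c x y z t : lext g (c *: (x + y) + z + t) =
  c * (lext g x + lext g y) + lext g z + lext g t :> F.
Proof. by rewrite !(lfD, lfZ). Qed.
Lemma lf_AS (g : hbasis -> F^o) c c' c'' x y z t p :
  lext g (- (c *: x) + c' *: (y + z) + c'' *: t - p) =
  - (c * lext g x) + c' * (lext g y + lext g z) + c'' * lext g t - lext g p :> F.
Proof. by rewrite !(lfD, lfN, lfZ). Qed.
Lemma lf_AP (g : hbasis -> F^o) c x y :
  lext g (c *: x - y) = c * lext g x - lext g y :> F.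
Proof. by rewrite !(lfD, lfN, lfZ). Qed.
Lemma lf_SS (g : hbasis -> F^o) c c' x y z t :
  lext g (c *: (x + y) - c' *: (z + t)) =
  c * (lext g x + lext g y) - c' * (lext g z + lext g t) :> F.
Proof. by rewrite !(lfD, lfN, lfZ). Qed.

Lemma lf_SS0 (g : hbasis -> F^o) c c' x y z t :
  lext g x = 0 -> lext g y = 0 -> lext g z = 0 -> lext g t = 0 ->
  lext g (c *: (x + y) - c' *: (z + t)) = 0 :> F.
Proof. by move=> gx gy gz gt; rewrite lf_SS gx gy gz gt addr0 !mulr0 subr0. Qed.

Definition lfunE := (afun_ha, afun_hs, afun_hp, afun_hz,
                     sfun_ha, sfun_hs, sfun_hp, sfun_hz).

Local Opaque Defs.ha Defs.hs Defs.hp Defs.hz lext.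

Section Recurrence.
Variables (D : nat) (alpha : 'I_D.+1 -> F).
Hypothesis alpha_sum : \sum_i alpha i = 0.
Hypothesis alpha_sym :
  exists2 eps : F, eps != 0 & forall i, alpha i = eps * alpha (rev_ord i).

Definition rsol u := forall m : int, \sum_i alpha i * u (m + i%:Z) = 0.

Lemma rsol_const a : rsol (fun=> a).
Proof. by move=> m; rewrite -mulr_suml alpha_sum mul0r. Qed.

Lemma rsolD u w : rsol u -> rsol w -> rsol (fun i => u i + w i).
Proof.
move=> su sw m; under eq_bigr do rewrite mulrDr.
by rewrite big_split /= su sw addr0.
Qed.

Lemma rsolZ a u : rsol u -> rsol (fun i => a * u i).
Proof.
by move=> su m; under eq_bigr do rewrite mulrCA; rewrite -mulr_sumr su mulr0.
Qed.

Lemma rsol_shift k u : rsol u -> rsol (fun i => u (k + i)).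
Proof. by move=> su m; under eq_bigr do rewrite addrA; apply: su. Qed.

(** Up to the factor [eps], the recurrence reads the same backwards. *)
Lemma rsol_reflect k u : rsol u -> rsol (fun i => u (k - i)).
Proof.
move=> su m; have [eps eps0 sym] := alpha_sym.
rewrite (reindex_inj rev_ord_inj) /=.
transitivity (\sum_i eps^-1 * (alpha i * u (k - m - D%:Z + i%:Z))); last first.
  by rewrite -mulr_sumr su mulr0.
apply: eq_bigr => i _; rewrite [alpha i]sym -mulrA (mulKf eps0) /=.
by congr (_ * u _); have := ltn_ord i; lia.
Qed.

Definition annih (v : H) : Prop :=
  (forall u, rsol u -> lext (afun u) v = 0) /\
  (forall w, rsol w -> (forall n, w (- n) = w n) -> lext (sfun w) v = 0).

Lemma lext_comb3 (g f1 f2 f3 : hbasis -> F^o) (a1 a2 a3 : F) v :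
  (forall y, g y = a1 * f1 y + a2 * f2 y + a3 * f3 y) ->
  lext f1 v = 0 -> lext f2 v = 0 -> lext f3 v = 0 -> lext g v = 0.
Proof.
move=> gE e1 e2 e3.
rewrite (eq_lext (g := fun y => a1 *: f1 y + a2 *: f2 y + a3 *: f3 y)) //.
by rewrite !lextD !lextZ e1 e2 e3 !scaler0 !addr0.
Qed.

Lemma even_abs w (x : int) : (forall n, w (- n) = w n) -> w `|x|%N%:Z = w x.
Proof. by move=> ew; have [|] := leP 0 x => xs; [|rewrite -ew]; congr w; lia. Qed.

(** Composing a defining functional with [lmul b] gives a combination of defining functionals. It
    suffices to check this on basis elements, case by case in b. *)
Lemma annih_lmul b v : annih v -> annih (lmul b v).
Proof.
have F4' := F4 F2; have F8' := F8 F2.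
have l0 v' : lext (fun=> 0 : F^o) v' = 0.
  by rewrite (eq_lext (g := fun=> 0 *: (0 : F^o))) ?lextZ ?scale0r // => y; rewrite scale0r.
move=> [av sv]; split=> [u su|w sw ew]; rewrite /lmul linear_lext.
- case: b => [k|l|b m].
  (* The axes in a_k s_j are paired symmetrically about k, so this is an even solution; the term
     -3/4 a_k supplies its value at 0. *)
  + pose u' i := u (k - i) + u (k + i).
    apply: (@lext_comb3 _ (afun (fun=> 1)) (afun u) (sfun u') (half * u k) half (q38 F)).
    * case=> [i|j|b m] /=;
        [rewrite lf_AA | rewrite /prodAS lf_AS | rewrite /prodAP lf_AP];
        rewrite !lfunE /u'.
      - by ring.
      - by rewrite subr0 addr0 /q34 /q38; field; rewrite F8' F4'.
      - by ring.
    * exact/av/rsol_const.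
    * exact: av.
    * apply: sv => [|n]; first exact: (rsolD (rsol_reflect k su) (rsol_shift k su)).
      by rewrite /u' opprK addrC.
  + pose u' i := - q34 F * u i + q38 F * (u (- l.+1%:Z + i) + u (l.+1%:Z + i)).
    apply: (@lext_comb3 _ (afun u') (fun=> 0) (fun=> 0) 1 0 0) => //.
    * case=> [i|j|b m] /=;
        [rewrite /prodAS lf_AS | rewrite lf_SS | rewrite /prodSP lf_SS];
        rewrite !lfunE /u'.
      - by rewrite [i - _]addrC [i + _]addrC; ring.
      - by ring.
      - by ring.
    * apply: av; apply: rsolD; first exact: rsolZ.
      by apply: rsolZ; apply: rsolD; apply: rsol_shift.
  (* Every product with a p lies in the span of the p's, where the functionals vanish. *)
  + apply: (@lext_comb3 _ (fun=> 0) (fun=> 0) (fun=> 0) 0 0 0) => //.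
    case=> [i|j|b' m'] /=.
    * by rewrite /prodAP lf_AP !afun_hp; ring.
    * by rewrite /prodSP lf_SS !afun_hp; ring.
    * have z r n := afun_hz u r n.
      by rewrite (lf_SS0 _ _ (z _ _) (z _ _) (z _ _) (z _ _)); ring.
- case: b => [k|l|b m].
  (* By evenness w at |k - i| is w at i - k, so the s-part of a_k a_i is seen by a shifted
     solution. *)
  + pose w' i := w (- k + i).
    apply: (@lext_comb3 _ (afun (fun=> 1)) (afun w') (sfun w) (- w 0) 1 (q32 F)).
    * case=> [i|j|b m] /=;
        [rewrite lf_AA | rewrite /prodAS lf_AS | rewrite /prodAP lf_AP];
        rewrite !lfunE /w'.
      - by rewrite even_abs // -ew opprB [i - k]addrC; ring.
      - by ring.
      - by ring.
    * exact/av/rsol_const.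
    * exact/av/rsol_shift.
    * exact: sv.
  + pose w' i := w (- l.+1%:Z + i) + w (l.+1%:Z + i).
    apply: (@lext_comb3 _ (afun (fun=> 1)) (sfun w) (sfun w')
      (q32 F * (w l.+1%:Z - w 0)) (q34 F) (- q38 F)).
    * case=> [i|j|b m] /=;
        [rewrite /prodAS lf_AS | rewrite lf_SS | rewrite /prodSP lf_SS];
        rewrite !lfunE /w'.
      - by ring.
      - rewrite /dist !even_abs // !addr0 ew PoszD.
        have -> : - l.+1%:Z + j.+1%:Z = - (l.+1%:Z - j.+1%:Z) by rewrite opprB addrC.
        rewrite ew /q34 /q38.
        by field; rewrite F8' F4'.
      - by ring.
    * exact/av/rsol_const.
    * exact: sv.
    * apply: sv => [|n]; first by apply: rsolD; apply: rsol_shift.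
      by rewrite /w' addrC -ew opprD opprK; congr (_ + _); rewrite -ew opprB addrC.
  + apply: (@lext_comb3 _ (fun=> 0) (fun=> 0) (fun=> 0) 0 0 0) => //.
    case=> [i|j|b' m'] /=.
    * by rewrite /prodAP lf_AP !sfun_hp; ring.
    * by rewrite /prodSP lf_SS !sfun_hp; ring.
    * have z r n := sfun_hz w r n.
      by rewrite (lf_SS0 _ _ (z _ _) (z _ _) (z _ _) (z _ _)); ring.
Qed.

Lemma annih_ideal : is_ideal annih.
Proof.
have annih0 : annih 0 by split=> *; rewrite linear0.
have annihD x y : annih x -> annih y -> annih (x + y).
  move=> [ax sx] [ay sy]; split=> [u su|w sw ew]; rewrite lfD.
    by rewrite ax // ay // addr0.
  by rewrite sx // sy // addr0.
have annihZ c x : annih x -> annih (c *: x).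
  move=> [ax sx]; split=> [u su|w sw ew]; rewrite lfZ.
    by rewrite ax // mulr0.
  by rewrite sx // mulr0.
exact: (is_ideal_lmul annih0 annihD annihZ annih_lmul).
Qed.

Lemma annih_lincomb : annih (lincomb alpha).
Proof.
split=> [u su|w sw ew]; rewrite linear_sum /=.
  rewrite -[RHS](su 0); apply: eq_bigr => i _.
  by rewrite lfZ afun_ha add0r.
by rewrite big1 // => i _; rewrite lfZ sfun_ha mulr0.
Qed.

End Recurrence.
End Annihilator.

(* The solution is [n |-> m-th coefficient of 'X^n modulo f], where [f] is the
   characteristic polynomial, modulo which 'X is invertible. *)
Lemma rsol_delta (F : fieldType) D (alpha : 'I_D.+1 -> F) (m : 'I_D) :
  alpha ord0 != 0 -> alpha ord_max != 0 ->
  exists2 u, rsol alpha u & forall k : 'I_D, u (k : nat)%:Z = (k == m)%:R.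
Proof.
move=> a0 aD; pose f := \poly_(i < D.+1) alpha (inord i).
have szf : size f = D.+1.
  by apply: size_poly_eq; rewrite (_ : inord D = ord_max) //; apply/val_inj/inordK.
(* Writing f = alpha_0 + 'X h, the choice g = - h / alpha_0 gives 'X g = 1 modulo f. So [e n] below
   represents the n-th power of 'X for every integer n. *)
pose g := - (alpha ord0)^-1 *: \poly_(i < D) alpha (inord i.+1).
have Xg : 'X * g = 1 - (alpha ord0)^-1 *: f.
  have -> : f = (alpha ord0)%:P + 'X * \poly_(i < D) alpha (inord i.+1).
    apply/polyP=> i; rewrite coefD coefC coefXM !coef_poly.
    case: i => [|i] /=; last by rewrite add0r.
    by rewrite addr0 (_ : inord 0 = ord0) //; apply/val_inj/inordK.
  rewrite scalerDr -mul_polyC -polyCM mulVf // opprD addrA subrr add0r.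
  by rewrite /g scaleNr mulrN -scalerAr.
pose e (n : int) : {poly F} := match n with Posz k => 'X^k | Negz k => g ^+ k.+1 end.
have eS n : ('X * e n) %% f = e (n + 1) %% f.
  case: n => [k|k]; first by rewrite /e -exprS -PoszD addn1.
  rewrite {1}/e exprS mulrA Xg mulrBl mul1r -scalerAl modpD modpN modpZl.
  rewrite modp_mulr scaler0 oppr0 addr0.
  case: k => [|k] //.
  by rewrite (_ : Negz k.+1 + 1 = Negz k) //; lia.
have eD n i : ('X^i * e n) %% f = e (n + i%:Z) %% f.
  elim: i n => [|i IH] n; first by rewrite mul1r addr0.
  rewrite exprSr -mulrA -modp_mul eS modp_mul IH.
  by congr (e _ %% f); lia.
exists (fun n => (e n %% f)`_m) => [n|k]; last first.
  by rewrite /e modp_small ?szf ?size_polyXn ?ltnS ?ltn_ord // coefXn eq_sym.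
(* The recurrence at n is the m-th coefficient of f times [e n] modulo f, which is zero. *)
transitivity (((f * e n) %% f)`_m); last by rewrite modp_mulr coef0.
rewrite {2}/f poly_def mulr_suml.
rewrite (big_morph (fun p : {poly F} => p %% f) (modpD f) (mod0p f)) coef_sum.
apply: eq_bigr => i _; rewrite -scalerAl modpZl coefZ eD.
by congr (alpha _ * _); apply/val_inj; rewrite /= inordK.
Qed.

(** * Linear algebra modulo an ideal *)

Section Codimension.
Variable F : fieldType.
Hypothesis F2 : (2%:R : F) != 0.
Hypothesis F3 : (3%:R : F) != 0.
Local Notation H := (HV F).
Local Notation ha := (ha F).

Lemma combZl n a (c : 'I_n -> F) (w : 'I_n -> H) :
  comb (fun i => a * c i) w = a *: comb c w.
Proof. by rewrite scaler_sumr; apply: eq_bigr => i _; rewrite scalerA. Qed.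

Lemma combBl n (c c' : 'I_n -> F) (w : 'I_n -> H) :
  comb (fun i => c i - c' i) w = comb c w - comb c' w.
Proof. by rewrite -sumrB; apply: eq_bigr => i _; rewrite scalerBl. Qed.

Lemma combB n (c : 'I_n -> F) (w w' : 'I_n -> H) :
  comb c (fun i => w i - w' i) = comb c w - comb c w'.
Proof. by rewrite -sumrB; apply: eq_bigr => i _; rewrite scalerBr. Qed.

Lemma comb_comb n m (c : 'I_n -> F) (N : 'I_n -> 'I_m -> F) (w : 'I_m -> H) :
  comb c (fun k => comb (N k) w) = comb (fun l => \sum_k c k * N k l) w.
Proof.
rewrite /comb; under eq_bigr do rewrite scaler_sumr.
rewrite exchange_big; apply: eq_bigr => l _; rewrite scaler_suml.
by apply: eq_bigr => k _; rewrite scalerA.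
Qed.

Lemma comb_delta n (k : 'I_n) (w : 'I_n -> H) : comb (fun l => (l == k)%:R) w = w k.
Proof.
rewrite /comb (bigD1 k) //= eqxx scale1r big1 ?addr0 // => l /negPf->.
by rewrite scale0r.
Qed.

Section Ideal.
Variable I : H -> Prop.
Hypothesis idI : is_ideal I.

Definition modspan n (w : 'I_n -> H) (v : H) := exists c, I (v - comb c w).
Definition modfree n (w : 'I_n -> H) := forall c, I (comb c w) -> forall k, c k = 0.

Lemma ideal_comb n c (w : 'I_n -> H) : (forall k, I (w k)) -> I (comb c w).
Proof. by move=> Iw; apply: (ideal_sum idI) => k; apply: (idealZ idI). Qed.

Lemma ideal_sub_trans x y z : I (x - y) -> I (y - z) -> I (x - z).
Proof. by move=> Ixy /(idealD idI Ixy); rewrite addrA subrK. Qed.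

Lemma modspan_gen n (w : 'I_n -> H) k : modspan w (w k).
Proof.
by exists (fun l => (l == k)%:R); rewrite comb_delta subrr; apply: ideal0.
Qed.

Lemma modspan_mod n (w : 'I_n -> H) u v : I (u - v) -> modspan w v -> modspan w u.
Proof. by move=> Iuv [c /(ideal_sub_trans Iuv)]; exists c. Qed.

Lemma modspan_comb n m (w : 'I_n -> H) (c : 'I_m -> F) (v : 'I_m -> H) :
  (forall k, modspan w (v k)) -> modspan w (comb c v).
Proof.
move=> /fin_all_exists [N IN]; exists (fun l => \sum_k c k * N k l).
by rewrite -comb_comb -combB; apply: ideal_comb.
Qed.

Lemma modspanZ n (w : 'I_n -> H) a v : modspan w v -> modspan w (a *: v).
Proof.
move=> [c /(idealZ idI a)]; rewrite scalerBr -combZl.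
by exists (fun i => a * c i).
Qed.

(** Freeness of v makes the transition matrices satisfy M N = 1. They are square, so N M = 1 as
    well, and a relation c among the w's satisfies c N = 0, hence c = 0. *)
Lemma modfree_exchange n (v w : 'I_n -> H) :
  (forall k, modspan w (v k)) -> (forall l, modspan v (w l)) ->
  modfree v -> modfree w.
Proof.
move=> /fin_all_exists [M IM] /fin_all_exists [N IN] fv.
pose Mm := \matrix_(k, l) M k l; pose Nm := \matrix_(k, l) N k l.
have MN : Mm *m Nm = 1%:M.
  apply/matrixP => k k'; apply/eqP; rewrite eq_sym -subr_eq0; apply/eqP.
  pose c k' := (k' == k)%:R - \sum_l M k l * N l k'.
  transitivity (c k'); first by rewrite !mxE eq_sym; under eq_bigr do rewrite !mxE.
  apply: fv; rewrite combBl comb_delta -comb_comb.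
  apply: (ideal_sub_trans (IM k)); rewrite -combB.
  exact: ideal_comb.
move=> c Ic k.
have cN : (\row_l c l) *m Nm = 0.
  apply/rowP => k'; rewrite !mxE.
  transitivity (\sum_l c l * N l k'); first by apply: eq_bigr => l _; rewrite !mxE.
  apply: (fv (fun k' => \sum_l c l * N l k')); rewrite -comb_comb.
  have := ideal_comb c IN; rewrite combB => /(idealB idI Ic).
  by rewrite opprB addrC subrK.
have := mulmx1C MN => NM.
have : (\row_l c l) *m (Nm *m Mm) = 0 by rewrite mulmxA cN mul0mx.
by rewrite NM mulmx1 => /rowP/(_ k); rewrite !mxE.
Qed.

(** * The first D axes as a basis of the axial span *)

Section Axial.
Variable D : nat.
Let w (k : 'I_D) := ha (k : nat)%:Z.

Lemma axial_codimP : (forall j, modspan w (ha j)) -> axial_codim I D <-> modfree w.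
Proof.
move=> sw; split=> [[v [vw fv wv]]|fw].
  apply: modfree_exchange fv => [k|l]; last exact: wv.
  have [n [idx [c Iv]]] := vw k.
  by apply: modspan_mod Iv _; apply: modspan_comb.
exists w; split=> [k||j]; last 2 first.
- exact: fw.
- exact: sw.
exists 1, (fun=> (k : nat)%:Z), (fun=> 1).
by rewrite big_ord1 scale1r subrr; apply: ideal0.
Qed.

(** A nonzero augmentation would put all axes into I, leaving no room for even one basis vector of
    the axial span. *)
Lemma axial_codim_sum0 n (c : 'I_n -> F) e : (0 < D)%N -> axial_codim I D ->
  I (comb c (fun i => ha (e i))) -> \sum_i c i = 0.
Proof.
move=> D0 [v [vw fv _]] Ic; apply/eqP/negP => /negP c0.
have Ia j : I (ha j) by apply: ideal_sum_neq0 Ic c0.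
pose k := Ordinal D0; have [m [idx [c' Iv]]] := vw k.
have /fv/(_ k)/eqP : I (comb (fun l => (l == k)%:R) v).
  rewrite comb_delta -[v k](subrK (comb c' (fun l => ha (idx l)))).
  by apply: (idealD idI Iv); apply: ideal_comb.
by rewrite eqxx oner_eq0.
Qed.

Variable alpha : 'I_D.+1 -> F.
Hypothesis a0 : alpha ord0 != 0.
Hypothesis aD : alpha ord_max != 0.
Hypothesis sum0 : \sum_i alpha i = 0.
Hypothesis Ialpha : I (lincomb alpha).

(** Translates of the relation, solved for their first or last axis, extend the window 0, ..., D - 1
    by one step at either end. *)
Lemma modspan_axes j : modspan w (ha j).
Proof.
have rel m : I (comb alpha (fun i : 'I_D.+1 => ha (m + (i : nat)%:Z))).
  exact: (ideal_translate F2 F3 idI sum0 m Ialpha).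
have solve n (c : 'I_n -> F) a x y : a != 0 -> I (a *: x + comb c y) ->
    (forall i, modspan w (y i)) -> modspan w x.
  move=> an0 Iaxy sy; rewrite -[x](scalerK an0); apply: modspanZ.
  have /modspanZ-/(_ (-1)) sc := modspan_comb c sy.
  by apply: modspan_mod sc; rewrite scaleN1r opprK.
suff main n i : (- n%:Z <= i)%R -> (i < D%:Z + n%:Z)%R -> modspan w (ha i).
  by apply: (main (`|j|%N).+1); lia.
elim: n i => [|n IH] i lo hi.
  have iD : (`|i| < D)%N by lia.
  by rewrite (_ : i = (Ordinal iD : nat)%:Z); [exact: modspan_gen | rewrite /=; lia].
have [lo'|lo'] := leP (- n%:Z) i; last first.
  have := rel i; rewrite {1}/comb big_ord_recl addr0 => /solve; apply=> // k.
  by apply: IH; rewrite /= /bump /=; have := ltn_ord k; lia.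
have [hi'|hi'] := ltP i (D%:Z + n%:Z); first exact: IH.
have := rel n%:Z; rewrite {1}/comb big_ord_recr [X in I X]addrC /=.
have -> : n%:Z + D%:Z = i by lia.
move=> /solve; apply=> // k.
by apply: IH; rewrite /=; have := ltn_ord k; lia.
Qed.

(** Subtracting the multiple of alpha with the same last coefficient leaves a relation among the
    first D axes, which are free modulo I. *)
Lemma relation_unique (beta : 'I_D.+1 -> F) : modfree w -> I (lincomb beta) ->
  forall i, beta i = beta ord_max / alpha ord_max * alpha i.
Proof.
move=> fw Ibeta; pose r := beta ord_max / alpha ord_max.
pose g i := beta i - r * alpha i.
have g_max : g ord_max = 0 by rewrite /g /r divfK ?subrr.
have : I (lincomb g).
  have := idealB idI Ibeta (idealZ idI r Ialpha).
  rewrite -[lincomb beta]/(comb _ _) -[lincomb alpha]/(comb _ _).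
  by rewrite -combZl -combBl.
rewrite /lincomb big_ord_recr /= g_max scale0r addr0 /= => /fw g0 i.
apply/eqP; rewrite -subr_eq0 -/(g i); apply/eqP.
have [iD|iD] := ltnP i D.
  by rewrite -(g0 (Ordinal iD)); congr g; apply: val_inj.
rewrite -g_max; congr g; apply/val_inj/anti_leq.
by rewrite /= iD -ltnS ltn_ord.
Qed.

End Axial.
End Ideal.
End Codimension.

(** * Generated ideals and the symmetry of patterns *)

Lemma gen_ideal_is_ideal (F : fieldType) (x : HV F) : is_ideal (gen_ideal x).
Proof.
split=> [|u v Iu Iv|c u Iu|u v Iv] I idI Ix; have [I0 ID IZ IM] := idI.
- exact: I0.
- by apply: ID; [apply: Iu | apply: Iv].
- by apply: IZ; apply: Iu.
- by apply: IM; apply: Iv.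
Qed.

Lemma gen_ideal_mem (F : fieldType) (x : HV F) : gen_ideal x x.
Proof. by move=> I _. Qed.

Lemma gen_ideal_sub (F : fieldType) (x y : HV F) :
  gen_ideal y x -> forall v, gen_ideal x v -> gen_ideal y v.
Proof. by move=> yx v; apply; first exact: gen_ideal_is_ideal. Qed.

Section Patterns.
Variable F : fieldType.
Hypothesis F2 : (2%:R : F) != 0.
Hypothesis F3 : (3%:R : F) != 0.
Variable D : nat.
Hypothesis D0 : (0 < D)%N.
Implicit Type alpha : 'I_D.+1 -> F.
Let w (k : 'I_D) := ha F (k : nat)%:Z.

(** The generated ideal lies in [annih alpha]; the solution that is 1 at k and 0 at the other
    initial places reads off c k. *)
Lemma gen_ideal_modfree alpha : ideal_type alpha ->
  modfree (gen_ideal (lincomb alpha)) w.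
Proof.
move=> [a0 aD sum0 [eps [epsE sym]]] c Ic k.
have idA : is_ideal (annih alpha).
  apply: (annih_ideal F2 F3 sum0); exists eps => //.
  by case: epsE => ->; rewrite ?oppr_eq0 oner_eq0.
have [u su uE] := rsol_delta k a0 aD.
have [/(_ u su) <- _] := Ic _ idA (annih_lincomb alpha).
rewrite /comb linear_sum /= (bigD1 k) //= big1 => [|l lk].
  by rewrite addr0 lfZ afun_ha uE eqxx mulr1.
by rewrite lfZ afun_ha uE (negPf lk) mulr0.
Qed.

Lemma gen_ideal_axial_codim alpha : ideal_type alpha ->
  axial_codim (gen_ideal (lincomb alpha)) D.
Proof.
move=> ta; have [a0 aD sum0 _] := ta.
have idG := gen_ideal_is_ideal (lincomb alpha).
apply/(axial_codimP idG); last exact: gen_ideal_modfree.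
by move=> j; apply: (modspan_axes F2 F3 idG a0 aD sum0); exact: gen_ideal_mem.
Qed.

Lemma has_pattern_ideal_type (I : HV F -> Prop) alpha :
  is_ideal I -> has_pattern I alpha -> ideal_type alpha.
Proof.
move=> idI [codimI a0 aD Ia].
have sum0 : \sum_i alpha i = 0.
  exact: (axial_codim_sum0 F2 F3 idI D0 codimI (e := fun i : 'I_D.+1 => (i : nat)%:Z) Ia).
have fw : modfree I w.
  suff sw : forall j, modspan I w (ha F j) by apply/(axial_codimP idI sw).
  move=> j; exact: (modspan_axes F2 F3 idI a0 aD sum0 Ia).
(* Reflecting i to D - i gives the reversed relation, which by uniqueness is a multiple [eps] of
   alpha. *)
have Irev : I (lincomb (fun i => alpha (rev_ord i))).
  suff <- : comb alpha (fun i : 'I_D.+1 => ha F (D%:Z - (i : nat)%:Z)) =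
            lincomb (fun i => alpha (rev_ord i)).
    exact: (ideal_reflect F2 F3 idI sum0 D%:Z Ia).
  rewrite /comb (reindex_inj rev_ord_inj); apply: eq_bigr => i _ /=.
  by have -> : D%:Z - (D.+1 - i.+1)%N%:Z = (i : nat)%:Z by have := ltn_ord i; lia.
have revE := relation_unique idI aD Ia fw Irev.
have rev0 : rev_ord ord0 = ord_max :> 'I_D.+1 by apply: val_inj; rewrite /= subn1.
have revD : rev_ord ord_max = ord0 :> 'I_D.+1 by apply: val_inj; rewrite /= subnn.
set eps := _ / _ in revE.
have := revE ord_max; have := revE ord0; rewrite rev0 revD => eD e0.
(* Reversing twice at an end coefficient gives alpha_0 = eps^2 alpha_0. *)
have : eps ^+ 2 == 1.
  by rewrite -(inj_eq (mulIf a0)) mul1r expr2 -mulrA -eD -e0.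
rewrite sqrf_eq1 => /orP epsE.
split=> //; exists eps; split; first by case: epsE => /eqP ->; [left | right].
by move=> i; rewrite -[in LHS](rev_ordK i) revE.
Qed.

End Patterns.

Theorem theorem1p7 (F : fieldType) (hF2 : (2%:R : F) != 0) (hF3 : (3%:R : F) != 0)
    (D : nat) (hD : (0 < D)%N) :
  (* the map lands in minimal ideals of axial codimension D *)
  (forall alpha : 'I_D.+1 -> F, ideal_type alpha ->
     minimal_ideal (gen_ideal (lincomb alpha)) D) /\
  (* it is well defined and injective on tuples up to non-zero scalars *)
  (forall alpha beta : 'I_D.+1 -> F, ideal_type alpha -> ideal_type beta ->
     ((forall v, gen_ideal (lincomb alpha) v <-> gen_ideal (lincomb beta) v) <->
      exists c : F, c != 0 /\ forall i, beta i = c * alpha i)) /\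
  (* it is surjective *)
  (forall I : HV F -> Prop, minimal_ideal I D ->
     exists alpha : 'I_D.+1 -> F, ideal_type alpha /\
       forall v, I v <-> gen_ideal (lincomb alpha) v).
Proof.
have pat (alpha : 'I_D.+1 -> F) : ideal_type alpha ->
    has_pattern (gen_ideal (lincomb alpha)) alpha.
  move=> ta; have [a0 aD _ _] := ta.
  by split=> //; apply: gen_ideal_axial_codim.
split; [|split] => [alpha ta|alpha beta ta tb|I [idI [alpha [pI minI]]]].
- split; first exact: gen_ideal_is_ideal.
  exists alpha; split; first exact: pat.
  by move=> J idJ [_ _ _ Ja] _ v; apply.
- have [_ aD _ _] := ta; have [_ bD _ _] := tb.
  split=> [eqab|[c [c0 bE]]].
    exists (beta ord_max / alpha ord_max); split.
      by rewrite mulf_neq0 // invr_eq0.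
    apply: (relation_unique (gen_ideal_is_ideal (lincomb alpha)) aD).
    - exact: gen_ideal_mem.
    - exact: gen_ideal_modfree.
    - by apply/eqab; apply: gen_ideal_mem.
  have lb : lincomb beta = c *: lincomb alpha.
    by rewrite /lincomb scaler_sumr; apply: eq_bigr => i _; rewrite bE scalerA.
  have ab : gen_ideal (lincomb alpha) (lincomb beta).
    by rewrite lb; apply: (idealZ (gen_ideal_is_ideal _)); apply: gen_ideal_mem.
  have ba : gen_ideal (lincomb beta) (lincomb alpha).
    by apply: (idealZI (gen_ideal_is_ideal _) c0); rewrite -lb; apply: gen_ideal_mem.
  by move=> v; split; apply: gen_ideal_sub.
(* The pattern of I is of ideal type, so the ideal it generates has the same pattern and lies in I;
   minimality gives equality. *)
have ta := has_pattern_ideal_type hF2 hF3 hD idI pI.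
exists alpha; split=> // v; have [_ _ _ Ia] := pI.
have sub u : gen_ideal (lincomb alpha) u -> I u by apply.
split; last exact: sub.
by apply: minI sub v; [apply: gen_ideal_is_ideal | apply: pat].
Qed.
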